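(* Let $\gamma>0$ and let $X$ be, under $\mathbb{P}$, a uniformly ergodic Markov chain with time-homogeneous rate matrix $A$. Let $\hat\tau$ be the first hitting time of a state $\hat x\in\mathcal{X}$. Then for any $\beta\ge0$ and any $\mathbb{Q}\in\mathcal{Q}_\gamma$, there exists a constant $k$ such that, for all $t\ge0$, $$E^{\mathbb{Q}}\big[(1+\hat\tau)^{1+\beta}\big|\mathcal{F}_t\big]\le k(1+t)^{1+\beta}.$$
   Context: Setting. Let $N\in\mathbb{N}\cup\{\infty\}$ and let $\mathcal{X}=\{e_i\}$ be the set of standard basis vectors of $\mathbb{R}^N$ ($\mathbb{R}^\infty$ is the space of real sequences). Vectors are column vectors, $z^*$ is the transpose of $z$, and $\mathbf{1}\in\mathbb{R}^N$ is the vector with all entries $1$. On $(\Omega,\mathcal{F},\mathbb{P})$, $X$ is a right-continuous pure-jump continuous-time process with values in $\mathcal{X}$ which is a Markov chain in its own filtration under $\mathbb{P}$, with (possibly infinite) rate matrix $A$; here $A_{ij}$ is the rate of jumping from $e_j$ to $e_i$, so $A_{ij}\ge0$ for $i\ne j$ and $\sum_iA_{ij}=0$ for all $j$, and the entries of $A$ are uniformly bounded. $\mathcal{F}_t$ is the completion of $\sigma(X_s:s\le t)$ by the $\mathbb{P}$-null sets of $\mathcal{F}_\infty$, and $\mathcal{F}=\mathcal{F}_\infty$. The first hitting time of $\hat x$ is $\inf\{t:X_t=\hat x\}$. Uniform ergodicity. $X$ is uniformly ergodic if there are a probability measure $\pi$ on $\mathcal{X}$ and constants $R,\rho>0$ such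 that $\sup_\mu\|P^A_t\mu-\pi\|_{TV}\le Re^{-\rho t}$ for all $t$, where the supremum is over all probability measures $\mu$ on $\mathcal{X}$, $P_t^A\mu$ is the law of $X_t$ given $X_0\sim\mu$ when $X$ evolves with rate matrix $A$, and $\|f\|_{TV}=\sum_x|f(x)|$. $\mathcal{Q}_\gamma$ is the family of all probability measures $\mathbb{Q}$ under which $X$ has compensator $\lambda$ (i.e. $X_t-X_0-\int_{]0,t]}\lambda(\omega,u)\,du$ is a $\mathbb{Q}$-martingale) for some predictable process $\lambda$ with $\mathbf{1}^*\lambda\equiv0$ and $(e_i^*\lambda(\omega,t))/(e_i^*AX_{t-})\in[\gamma,\gamma^{-1}]$ for all $i$, where $0/0:=1$.
   Formalization: The state x̂ is additionally assumed to satisfy π(x̂)>0 for the ergodic measure π; without this the claim fails, e.g. for two states with e_1 absorbing, X_0=e_1 and x̂=e_2, where the hitting time is infinite. *)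

(* Defs.v *)
From HB Require Import structures.
From mathcomp Require Import all_boot all_order all_algebra.
From mathcomp Require Import all_classical all_reals all_analysis.
From mathcomp Require Import measurable_realfun.
Import Order.TTheory GRing.Theory Num.Theory.
Import numFieldNormedType.Exports.

Set Implicit Arguments.
Unset Strict Implicit.
Unset Printing Implicit Defensive.

Local Open Scope classical_set_scope.
Local Open Scope ring_scope.

(* Conventions.
   - N in {0, 1, ...} u {oo} is an [option nat] ([None] is oo); the coordinates
     of R^N are indexed by [idx N] and a vector of R^N is a function
     [idx N -> R].
   - The state e_i is represented by its index i, so that a process with values
     in {e_i} is a map [X : R -> T -> I]; [bvec i] is the vector e_i, and
     A e_j is the column [fun i => A i j].
   - Times are real numbers t >= 0; values of a process at negative times are
     never used. *)

Definition below (N : option nat) (i : nat) : bool :=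
  if N is Some n then (i < n)%N else true.

Notation idx N := {i : nat | below N i}.

Section vectors.
Context {R : realType} {I : countType}.

Definition bvec (i : I) : I -> R := fun k => (k == i)%:R.

(* sum_i a_i = l, as an absolutely convergent series *)
Definition sums_to (a : I -> R) (l : R) : Prop :=
  summable [set: I] (EFin \o a) /\
  (\esum_(i in [set: I]) (EFin \o a)^\+ i
    - \esum_(i in [set: I]) (EFin \o a)^\- i = l%:E)%E.

Definition is_pmf (p : I -> R) : Prop :=
  (forall i, 0 <= p i) /\ (\esum_(i in [set: I]) (p i)%:E = 1)%E.

(* no factor 1/2 *)
Definition tv_norm (f : I -> R) : \bar R :=
  (\esum_(i in [set: I]) `|f i|%:E)%E.

Definition bounded_rate_matrix (A : I -> I -> R) : Prop :=
  [/\ forall i j, i != j -> 0 <= A i j,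
      forall j, sums_to (fun i => A i j) 0 &
      exists C : R, forall i j, `|A i j| <= C].

(* [Pt t i j] is the probability of moving from j to i in time t; as A is
   bounded and conservative, these conditions determine Pt. *)
Definition transition_semigroup (A : I -> I -> R) (Pt : R -> I -> I -> R)
    : Prop :=
  [/\ forall (t : R) j, 0 <= t -> is_pmf (fun i => Pt t i j),
      forall i j, Pt 0 i j = (i == j)%:R,
      forall (s t : R) i j, 0 <= s -> 0 <= t ->
        (Pt (s + t) i j)%:E
          = \esum_(k in [set: I]) (Pt s i k * Pt t k j)%:E &
      forall i j,
        (fun h => (Pt h i j - (i == j)%:R) / h) @ (0 : R)^'+ --> A i j].

(* the law at time t of the chain started from the law mu *)
Definition law_at (Pt : R -> I -> I -> R) (t : R) (mu : I -> R) : I -> R :=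
  fun i => fine (\esum_(j in [set: I]) (Pt t i j * mu j)%:E).

Definition uniformly_ergodic (Pt : R -> I -> I -> R) (pi : I -> R) : Prop :=
  is_pmf pi /\
  exists C rho : R, [/\ 0 < C, 0 < rho &
    forall (t : R) (mu : I -> R), 0 <= t -> is_pmf mu ->
      (tv_norm (fun i => law_at Pt t mu i - pi i)%R
         <= (C * expR (- rho * t))%:E)%E].

(* a / b with 0 / 0 = 1; since x / 0 = 0 in MathComp, the value for a != 0 and
   b = 0 lies outside [gamma, gamma^-1] when gamma > 0, as it should *)
Definition ratio (a b : R) : R :=
  if (a == 0) && (b == 0) then 1 else a / b.

End vectors.

Section processes.
Context {d : measure_display} {T : measurableType d} {R : realType}.

Definition measurable_wrt (G : set (set T)) {d'} {U : measurableType d'}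
    (f : T -> U) : Prop :=
  forall B : set U, measurable B -> G (f @^-1` B).

(* Y is a version of the conditional expectation E^Q[Z | G] of the nonnegative
   extended random variable Z *)
Definition is_cond_expectation (Q : probability T R) (G : set (set T))
    (Z Y : T -> \bar R) : Prop :=
  [/\ measurable_wrt G Y, forall w, (0 <= Y w)%E &
      forall B, G B -> (\int[Q]_(w in B) Y w = \int[Q]_(w in B) Z w)%E].

Definition is_martingale (Q : probability T R) (F : R -> set (set T))
    (M : R -> T -> R) : Prop :=
  [/\ forall t : R, 0 <= t -> measurable_wrt (F t) (M t),
      forall t : R, 0 <= t -> Q.-integrable setT (EFin \o M t) &
      forall (s t : R) B, 0 <= s -> s <= t -> F s B ->
        (\int[Q]_(w in B) (M t w)%:E = \int[Q]_(w in B) (M s w)%:E)%E].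

(* the predictable sigma-algebra on [0, oo[ x T *)
Definition predictable_sets (F : R -> set (set T)) : set (set (R * T)) :=
  <<s `[0, +oo[ `*` [set: T],
    [set D | (exists2 B, F 0 B & D = [set 0] `*` B) \/
             (exists (s t : R) B, [/\ 0 <= s, s < t, F s B & D = `]s, t] `*` B])] >>.

Definition predictable (F : R -> set (set T)) (f : R -> T -> R) : Prop :=
  forall B : set R, measurable B ->
    predictable_sets F [set z | 0 <= z.1 /\ B (f z.1 z.2)].

Section chain.
Context {I : countType}.
Variable X : R -> T -> I.

(* For a discrete state space, right-continuity and existence of left limits in
   the state space mean that each path is piecewise constant with finitely many
   jumps on bounded intervals. *)
Definition right_continuous_pure_jump : Prop :=
  forall w, (forall t, 0 <= t -> \forall s \near t^'+, X s w = X t w) /\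
            (forall t, 0 < t -> exists i, \forall s \near t^'-, X s w = i).

(* X_{t-}, with X_{0-} = X_0 *)
Definition left_limit (t : R) (w : T) : I :=
  if t <= 0 then X 0 w
  else xget (X 0 w) [set i | \forall s \near t^'-, X s w = i].

(* sigma(X_s : s <= t) *)
Definition natural_filtration (t : R) : set (set T) :=
  <<s [set X s @^-1` [set i] | i in [set: I] & s in [set s : R | 0 <= s <= t]] >>.

Definition natural_sigma : set (set T) :=
  <<s [set X s @^-1` [set i] | i in [set: I] & s in [set s : R | 0 <= s]] >>.

Variable P : probability T R.

(* the null sets of the P-completion of sigma(X_s : s >= 0) *)
Definition null_sets : set (set T) :=
  [set M | exists B, [/\ natural_sigma B, P B = 0%E & M `<=` B]].

Definition filt (t : R) : set (set T) :=
  <<s natural_filtration t `|` null_sets >>.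

Definition filt_infty : set (set T) := <<s natural_sigma `|` null_sets >>.

Definition markov_chain (Pt : R -> I -> I -> R) : Prop :=
  forall (s t : R) (i : I) B, 0 <= s -> s <= t -> natural_filtration s B ->
    (P (B `&` [set w | X t w = i])
       = \int[P]_(w in B) (Pt (t - s) i (X s w))%:E)%E.

(* X_t - X_0 - int_]0,t] lam(u) du is a vector martingale under Q *)
Definition has_compensator (Q : probability T R) (lam : R -> T -> I -> R)
    : Prop :=
  forall i, is_martingale Q filt
    (fun t w => bvec (X t w) i - bvec (X 0 w) i
                - \int[lebesgue_measure]_(u in `]0, t]) lam u w i).

Definition Q_family (A : I -> I -> R) (gamma : R) : set (probability T R) :=
  [set Q | exists lam : R -> T -> I -> R,
    [/\ forall i, predictable filt (fun t w => lam t w i),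
        forall (t : R) w, 0 <= t -> sums_to (lam t w) 0,
        forall (t : R) w i, 0 <= t ->
          gamma <= ratio (lam t w i) (A i (left_limit t w)) <= gamma^-1 &
        has_compensator Q lam]].

(* inf {t : X_t = x}, equal to +oo when x is never hit *)
Definition hitting_time (x : I) (w : T) : \bar R :=
  ereal_inf [set t%:E | t in [set t : R | 0 <= t /\ X t w = x]].

End chain.
End processes.

(* Main.v *)
Require Import Defs.
From HB Require Import structures.
From mathcomp Require Import all_boot all_order all_algebra.
From mathcomp Require Import all_classical all_reals all_analysis.
From mathcomp Require Import measurable_realfun.
From mathcomp Require Import lra ring.
Import Order.TTheory GRing.Theory Num.Theory.
Import numFieldNormedType.Exports.
Local Open Scope classical_set_scope.
Local Open Scope ring_scope.

(* The potential g(j) = sup_(s >= 0) e^-s P(X_s = xhat | X_0 = j) is bounded,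
   bounded below by uniform ergodicity, and satisfies sum_i A_ij g(i) >= g(j)
   for j != xhat.  Hence f = exp (L (g - 1)) with L large has, off xhat, a drift
   at least c > 0 under every admissible compensator.  Integrating the
   martingales of Q against f over [t, t + S] with c S = 2 shows that, given
   F_t, xhat is avoided on [t, t + S] with probability at most theta < 1; no
   stopping is needed, because the drift is also bounded below at xhat.
   Iterating, the hitting time beyond t has a geometric tail uniformly in t, so
   all its conditional moments are bounded as claimed. *)

(** * A potential with positive drift under all admissible rates *)

(** The martingale property is given one coordinate at a time, so on an infinite state space it
    reaches finite combinations of coordinates and not f itself. All drift estimates are therefore
    made for f cut off to the first m states. Since f and the off-diagonal rates are nonnegative,
    the global lower bound on the drift holds for every m at once. The bound c, in contrast, holds
    only from a rank m that depends on the current state, because the jumps that raise g may lead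
    arbitrarily far out. The one-step estimate is thus proved on the event that the path visits only
    states of rank at most m during [t, t + S]; these events exhaust the space as m grows, while
    theta does not depend on m. Conditioning on F_t is expressed by integrating over the events of
    F_t. *)

Lemma cvg_sumr (R : realType) (I T : Type) (F : set_system T) (r : seq I)
    (f : I -> T -> R) (l : I -> R) : Filter F ->
  (forall i, f i x @[x --> F] --> l i) ->
  \sum_(i <- r) f i x @[x --> F] --> \sum_(i <- r) l i.
Proof.
move=> FF h; apply: (@cvg_big _ _ (fun x y : R => x + y)) => //.
exact: add_continuous.
Qed.

Lemma esum_seq_ge (R : realType) (I : choiceType) (a : I -> R) (F : seq I) :
  (forall i, 0 <= a i) -> uniq F ->
  ((\sum_(i <- F) a i)%:E <= \esum_(i in [set: I]) (a i)%:E)%E.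
Proof.
move=> a0 uF; apply: ereal_sup_ubound; exists [set` F].
  by split => //; exact: finite_seq.
by rewrite -fsbig_seq// sumEFin.
Qed.

Lemma esum_seq_le (R : realType) (I : choiceType) (a : I -> R) (M : \bar R) :
  (forall F : seq I, uniq F -> ((\sum_(i <- F) a i)%:E <= M)%E) ->
  (\esum_(i in [set: I]) (a i)%:E <= M)%E.
Proof.
move=> H; apply: ge_ereal_sup => _ /= [X [finX _]] <-.
by rewrite fsbig_finite//= sumEFin; exact: H.
Qed.

Section pmf.
Context {R : realType} {I : countType} {p : I -> R}.
Hypothesis hp : is_pmf p.

Lemma pmf_sum_le1 (F : seq I) : uniq F -> \sum_(i <- F) p i <= 1.
Proof.
move=> uF; have [p0 p1] := hp.
by rewrite -lee_fin (le_trans (esum_seq_ge _ _ _ _ p0 uF))// p1.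
Qed.

Lemma pmf_le1 i : p i <= 1.
Proof. by have := @pmf_sum_le1 [:: i] isT; rewrite big_seq1. Qed.

(** Outside F each weight is replaced by 1, and the mass left there is at most 1 minus the mass of
    F. This turns the infinite Chapman-Kolmogorov sum into a finite one plus the leaked mass. *)
Lemma pmf_weighted_esum_le (b : I -> R) (F : seq I) :
  (forall i, 0 <= b i <= 1) -> uniq F ->
  (\esum_(i in [set: I]) (b i * p i)%:E <=
   (\sum_(i <- F) b i * p i + (1 - \sum_(i <- F) p i))%:E)%E.
Proof.
move=> hb uF; have [p0 p1] := hp.
apply: esum_seq_le => G uG; rewrite lee_fin.
rewrite (bigID (mem F))/= lerD//.
  rewrite [leLHS](_ : _ = \sum_(i <- F | i \in G) b i * p i).
    rewrite [leRHS](bigID (mem G))/= lerDl sumr_ge0// => i _.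
    by rewrite mulr_ge0//; case/andP: (hb i).
  rewrite -big_filter -[RHS]big_filter; apply: perm_big.
  by apply: uniq_perm; rewrite ?filter_uniq// => i; rewrite !mem_filter andbC.
rewrite lerBrDr (@le_trans _ _ (\sum_(i <- G | i \notin F) p i + \sum_(i <- F) p i))//.
  by rewrite lerD2r ler_sum// => i _; rewrite ler_piMl//; case/andP: (hb i).
rewrite -big_filter addrC -big_cat pmf_sum_le1//.
rewrite cat_uniq uF filter_uniq// andbT/=.
by apply/hasPn => i; rewrite mem_filter => /andP[].
Qed.

End pmf.

(** Finite exhaustion of I along its countable encoding; it serves as the cutoff of f. *)
Definition initial (I : countType) (n : nat) : seq I :=
  pmap (@pickle_inv I) (iota 0 n).

Lemma initial_uniq (I : countType) n : uniq (initial I n).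
Proof. by apply: (pmap_uniq (@pickle_invK I)); exact: iota_uniq. Qed.

Lemma mem_initial (I : countType) n (i : I) : (i \in initial I n) = (pickle i < n)%N.
Proof.
rewrite mem_pmap; apply/mapP/idP => [[k]|lt_in].
  rewrite mem_iota add0n => /= kn e.
  by have := @pickle_invK I k; rewrite -e /= => ->.
by exists (pickle i); rewrite ?mem_iota//= pickleK_inv.
Qed.

Section potential.
Context {R : realType} {I : countType} {A : I -> I -> R}.
Context {Pt : R -> I -> I -> R} {nu : I -> R}.
Hypotheses (HA : bounded_rate_matrix A) (HPt : transition_semigroup A Pt).
Hypothesis Hergodic : uniformly_ergodic Pt nu.
Variable x : I.
Hypothesis nux : 0 < nu x.

Let pmfP (t : R) (j : I) : 0 <= t -> is_pmf (fun i => Pt t i j).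
Proof. by move=> t0; have [+ _ _ _] := HPt; exact. Qed.

(** The ergodic bound for point masses is uniform in the starting state, and a single coordinate is
    at most the whole norm. Once the bound is below [nu x / 2], the probability of x stays within
    that distance of [nu x], which is positive. *)
Lemma ergodic_minorization :
  exists2 S : R, 0 <= S & forall j, nu x / 2 <= Pt S x j.
Proof.
have [_ [C [rho [C0 rho0 HC]]]] := Hergodic.
(* Here rho S = C / (nu x / 2), so e^y >= 1 + y already gives C e^(- rho S) <= nu x / 2. *)
pose S := C / (rho * (nu x / 2)).
have S0 : 0 <= S by rewrite divr_ge0// ?mulr_ge0// ?divr_ge0// ltW.
exists S => // j.
pose mu : I -> R := bvec j.
have hmu : is_pmf mu.
  split => [i|]; first by rewrite /mu /bvec ler0n.
  rewrite (esumID [set j]) ?setTI//; last by move=> i _; rewrite lee_fin ler0n.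
  rewrite esum_set1 ?lee_fin ?ler0n// [X in (_ + X)%E]esum1 ?adde0 /mu /bvec ?eqxx//.
  by move=> i /eqP/negbTE ->.
have law : law_at Pt S mu x = Pt S x j.
  rewrite /law_at (esumID [set j]) ?setTI//; last first.
    move=> i _; rewrite lee_fin mulr_ge0// ?ler0n//.
    by case: (pmfP S i S0).
  rewrite esum_set1 ?lee_fin ?mulr_ge0 ?ler0n//; last by case: (pmfP S j S0).
  rewrite [X in (_ + X)%E]esum1 ?adde0 /mu /bvec ?eqxx ?mulr1//.
  by move=> i /eqP/negbTE ->; rewrite mulr0.
have := HC S mu S0 hmu.
have : (`|law_at Pt S mu x - nu x|%:E <= tv_norm (fun i => law_at Pt S mu i - nu i)%R)%E.
  rewrite /tv_norm.
  by have := @esum_seq_ge R I (fun i => `|law_at Pt S mu i - nu i|) [:: x]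
    (fun i => normr_ge0 _) isT; rewrite big_seq1.
move=> /le_trans h /h{h}; rewrite law lee_fin => h.
suff : C * expR (- rho * S) <= nu x / 2.
  by move=> /(le_trans h); rewrite ler_distl => /andP[+ _]; lra.
rewrite mulNr expRN ler_pdivrMr ?expR_gt0//.
have e1 : 1 + rho * S <= expR (rho * S) by exact: expR_ge1Dx.
apply: (le_trans _ (ler_wpM2l _ e1)); last by rewrite divr_ge0// ltW.
have -> : rho * S = C / (nu x / 2).
  by rewrite /S; field; rewrite ?gt_eqF.
have -> : nu x / 2 * (1 + C / (nu x / 2)) = nu x / 2 + C by field; rewrite gt_eqF.
by rewrite lerDr divr_ge0// ltW.
Qed.

(** Started from j in F, the probability of being in F is 1 at time 0 and at most 1 later, so its
    right derivative at 0 cannot be positive. *)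
Lemma rate_partial_sum_le0 (F : seq I) j : uniq F -> j \in F ->
  \sum_(i <- F) A i j <= 0.
Proof.
move=> uF jF; have [_ _ _ H] := HPt.
have cv : (fun h => \sum_(i <- F) ((Pt h i j - (i == j)%:R) / h)) @ 0^'+
    --> \sum_(i <- F) A i j.
  exact: cvg_sumr.
rewrite -(cvg_lim _ cv)//; apply: limr_le; first by apply/cvg_ex; eexists; exact: cv.
near=> h; have h0 : 0 < h by near: h; exact: nbhs_right_gt.
rewrite -mulr_suml sumrB pmulr_lle0 ?invr_gt0// subr_le0.
rewrite (@le_trans _ _ 1)//; first exact: (pmf_sum_le1 (pmfP h j (ltW h0))).
rewrite (bigD1_seq j)//= eqxx lerDl sumr_ge0// => i _; exact: ler0n.
Unshelve. all: by end_near. Qed.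

(* the value at j of optimal stopping, with discount rate 1, of the transition
   probability to x: taking a supremum instead of an integral over time makes
   the drift of g at least g away from x without any regularity of Pt in time *)
Let g j := sup [set expR (- s) * Pt s x j | s in [set s : R | 0 <= s]].

Let g_has_sup j : has_sup [set expR (- s) * Pt s x j | s in [set s : R | 0 <= s]].
Proof.
split; first by exists (expR (- 0) * Pt 0 x j), 0 => //=.
exists 1 => _ [s /= s0 <-]; rewrite mulr_ile1 ?expR_ge0//.
- by case: (pmfP s j s0).
- by rewrite -expR0 ler_expR oppr_le0.
- exact: pmf_le1 (pmfP s j s0) _.
Qed.

Let g_ge s j : 0 <= s -> expR (- s) * Pt s x j <= g j.
Proof. by move=> s0; apply: sup_upper_bound; [exact: g_has_sup|exists s]. Qed.

Let g_le1 j : g j <= 1.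
Proof.
apply: ge_sup; first by exists (expR (- 0) * Pt 0 x j), 0 => //=.
move=> _ [s /= s0 <-]; rewrite mulr_ile1 ?expR_ge0//.
- by case: (pmfP s j s0).
- by rewrite -expR0 ler_expR oppr_le0.
- exact: pmf_le1 (pmfP s j s0) _.
Qed.

Let g_ge0 j : 0 <= g j.
Proof.
apply: le_trans (g_ge 0 j (lexx _)); rewrite mulr_ge0 ?expR_ge0//.
by case: (pmfP 0 j (lexx _)).
Qed.

(** Dynamic programming over a short time h. Times s < h contribute at most g j / 2, as j is not x,
    so the supremum is governed by s >= h; there Chapman-Kolmogorov gives e^h g j <= M, where M
    averages g over F and counts the mass outside F with weight 1. Using e^h >= 1 + h, subtracting g
    j and dividing by h gives the bound; the subtracted sum of rates comes from the leaked mass. *)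
Let g_drift (F : seq I) j : uniq F -> j \in F -> j != x -> 0 < g j ->
  g j <= \sum_(i <- F) A i j * g i - \sum_(i <- F) A i j.
Proof.
move=> uF jF jx gj0; have [_ P0 CK H] := HPt.
have cv : (fun h => \sum_(i <- F) ((Pt h i j - (i == j)%:R) / h) * g i
    - \sum_(i <- F) ((Pt h i j - (i == j)%:R) / h)) @ 0^'+
    --> \sum_(i <- F) A i j * g i - \sum_(i <- F) A i j.
  apply: cvgB; apply: cvg_sumr => //.
  by move=> i; apply: cvgMr_tmp; exact: H.
rewrite -(cvg_lim _ cv)//; apply: limr_ge; first by apply/cvg_ex; eexists; exact: cv.
have Px0 : Pt h x j @[h --> 0^'+] --> 0.
  suff : Pt h x j @[h --> 0^'+] --> A x j * 0 by rewrite mulr0.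
  have := cvgM (H x j) (cvg_at_right_filter (@cvg_id _ (nbhs (0 : R)))); move/(_ _).
  apply: cvg_trans; apply: near_eq_cvg; near=> h.
  have h0 : 0 < h by near: h; exact: nbhs_right_gt.
  by rewrite /= (eq_sym x) (negbTE jx) subr0 divfK// gt_eqF.
have [e /= e0 He] : \forall h \near 0^'+, Pt h x j < g j / 2.
  by apply: (cvgr_lt _ Px0); rewrite divr_gt0.
near=> h.
have h0 : 0 < h by near: h; exact: nbhs_right_gt.
have he : h < e by near: h; exact: nbhs_right_lt.
have small s : 0 <= s -> s < h -> expR (- s) * Pt s x j <= g j / 2.
  rewrite le_eqVlt => /predU1P[<- _|s0 sh].
    by rewrite P0 eq_sym (negbTE jx) mulr0 divr_ge0.
  apply: (@le_trans _ _ (Pt s x j)).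
    by rewrite ler_piMl// ?(proj1 (pmfP s j (ltW s0)))// -expR0 ler_expR oppr_le0 ltW.
  apply/ltW/He => //=.
  by rewrite sub0r normrN gtr0_norm// (lt_trans sh).
set M := \sum_(i <- F) g i * Pt h i j + (1 - \sum_(i <- F) Pt h i j).
have large s : h <= s -> expR (- s) * Pt s x j <= expR (- h) * M.
  move=> hs; have sh0 : 0 <= s - h by rewrite subr_ge0.
  have -> : - s = - h + - (s - h) by ring.
  rewrite expRD -mulrA ler_wpM2l ?expR_ge0//.
  have hb i : 0 <= Pt (s - h) x i <= 1.
    by rewrite (proj1 (pmfP _ i sh0)) (pmf_le1 (pmfP _ i sh0)).
  have hb' i : 0 <= expR (- (s - h)) * Pt (s - h) x i <= 1.
    by rewrite (le_trans (g_ge _ _ sh0))// mulr_ge0 ?expR_ge0//; case/andP: (hb i).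
  have := pmf_weighted_esum_le (pmfP h j (ltW h0)) _ _ hb uF.
  rewrite -CK ?(ltW h0)// subrK lee_fin.
  move=> /(ler_wpM2l (expR_ge0 (- (s - h)))) /le_trans; apply.
  rewrite mulrDr; apply: lerD.
    rewrite mulr_sumr; apply: ler_sum => i _.
    by rewrite mulrA ler_wpM2r ?g_ge//; case: (pmfP h j (ltW h0)).
  rewrite ler_piMl ?subr_ge0 ?(pmf_sum_le1 (pmfP h j (ltW h0)))//.
  by rewrite -expR0 ler_expR oppr_le0.
have gM : g j <= expR (- h) * M.
  have : g j <= Num.max (expR (- h) * M) (g j / 2).
    apply: ge_sup; first by exists (expR (- 0) * Pt 0 x j), 0 => //=.
    move=> _ [s /= s0 <-]; rewrite le_max.
    by have [/large ->//|/(small _ s0) ->] := leP h s; rewrite orbT.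
  by rewrite le_max => /orP[//|]; lra.
have {gM} : (1 + h) * g j <= M.
  rewrite expRN mulrC ler_pdivlMr ?expR_gt0// in gM.
  by apply: le_trans gM; rewrite mulrC ler_wpM2l// expR_ge1Dx.
have Fj : \sum_(i <- F) (i == j)%:R = 1 :> R.
  by rewrite (bigD1_seq j)//= eqxx big1 ?addr0// => i /negbTE ->.
have Fgj : \sum_(i <- F) (i == j)%:R * g i = g j.
  by rewrite (bigD1_seq j)//= eqxx mul1r big1 ?addr0// => i /negbTE ->; rewrite mul0r.
under eq_bigr do rewrite mulrAC.
rewrite -!mulr_suml -mulrBl ler_pdivlMr// sumrB Fj.
under [X in _ <= X - _]eq_bigr do rewrite mulrBl.
rewrite sumrB Fgj /M.
under [X in _ <= X + _ -> _]eq_bigr do rewrite mulrC.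
by lra.
Unshelve. all: by end_near. Qed.

(** The column sums to 0, so its positive part totals at least - A j j, and some finite set captures
    this up to e. Off the diagonal the entries are nonnegative, so enlarging the set only helps. *)
Lemma rate_partial_sum_cvg0 j (e : R) : 0 < e ->
  exists n, forall m, (n <= m)%N ->
    j \in initial I m /\ - e <= \sum_(i <- initial I m) A i j.
Proof.
move=> e0; have [A0 /(_ j)[_ sA] _] := HA.
have Ajj : A j j <= 0.
  by have := rate_partial_sum_le0 [:: j] j isT (mem_head _ _); rewrite big_seq1.
pose p i := Num.max (A i j) 0.
have p0 i : 0 <= p i by rewrite le_max lexx orbT.
pose q i := Num.max (- A i j) 0.
have q0 i : 0 <= q i by rewrite le_max lexx orbT.
have : ((- A j j - e)%:E < \esum_(i in [set: I]) (p i)%:E)%E.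
  have := @esum_seq_ge R I q [:: j] q0 isT.
  have : (\esum_(i in [set: I]) (p i)%:E - \esum_(i in [set: I]) (q i)%:E = 0)%E.
    rewrite -[RHS]sA; congr (_ - _)%E; apply: eq_esum => i _.
      by rewrite funeposE /p EFin_max.
    by rewrite funenegE /q EFin_max.
  rewrite big_seq1 /q (max_idPl _) ?oppr_ge0//.
  case: (esum _ (fun i => (p i)%:E)) => [u| |]; case: (esum _ _) => [v| |]//=.
  by rewrite -EFinB => -[]; rewrite lte_fin lee_fin; lra.
move=> /ereal_sup_gt[_ /= [X [finX _] <-]].
rewrite fsbig_finite//= sumEFin lte_fin.
move: (finmap.fset_uniq (fset_set X)); move: (finmap.enum_fset _) => G uG hX.
exists (maxn (pickle j) (\max_(i <- G) pickle i)).+1 => m nm.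
have jm : j \in initial I m by rewrite mem_initial (leq_trans _ nm)// ltnS leq_maxl.
have Xm i : i \in G -> i \in initial I m.
  move=> iX; rewrite mem_initial (leq_trans _ nm)// ltnS leq_max; apply/orP; right.
  exact: leq_bigmax_seq.
split => //; rewrite (bigD1_seq j)//= ?initial_uniq//.
suff : \sum_(i <- G) p i <= \sum_(i <- initial I m | i != j) A i j by lra.
have -> : \sum_(i <- initial I m | i != j) A i j = \sum_(i <- initial I m) p i.
  rewrite [RHS](bigD1_seq j) ?initial_uniq//= {1}/p (max_idPr _)// add0r.
  by apply: eq_bigr => i ij; rewrite /p (max_idPl _)// A0.
rewrite [leRHS](bigID (mem G))/= -[leLHS]addr0 lerD ?sumr_ge0//.
rewrite -[leRHS]big_filter le_eqVlt; apply/orP; left; apply/eqP; apply: perm_big.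
apply: uniq_perm; rewrite ?filter_uniq ?initial_uniq ?uG// => i.
by rewrite mem_filter; case: (boolP (i \in _)) => //= /Xm ->.
Qed.

(* Exponentiating g makes the upward jumps outweigh the downward ones, so that
   the drift stays positive even when the upward rates are multiplied by gamma
   and the total rate by 1 / gamma. *)
Lemma robust_drift (gamma : R) : 0 < gamma ->
  exists (f : I -> R) (c D : R), [/\ 0 < c, 0 <= D,
    forall j, 0 <= f j <= 1,
    forall j (a : I -> R), (forall i, i != j -> gamma * A i j <= a i) ->
      A j j / gamma <= a j -> forall n, - D <= \sum_(i <- initial I n) a i * f i &
    forall j, j != x -> exists n, forall m, (n <= m)%N ->
    forall (a : I -> R), (forall i, i != j -> gamma * A i j <= a i) ->
      A j j / gamma <= a j -> c <= \sum_(i <- initial I m) a i * f i].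
Proof.
move=> ga0; have [A0 _ [C HC]] := HA.
have C0 : 0 <= C by apply: le_trans (HC x x).
have [S S0 HS] := ergodic_minorization.
pose c1 := expR (- S) * (nu x / 2).
have c10 : 0 < c1 by rewrite mulr_gt0 ?expR_gt0// divr_gt0.
have gc1 j : c1 <= g j.
  by apply: le_trans (g_ge _ _ S0); rewrite ler_wpM2l ?expR_ge0//.
(* [mm] and [L] are dictated by the tangent to exp at [mm] used below. [L] makes L (c1 / 2) - (mm -
   1) C equal to 1; [mm] makes gamma e^mm at least C / gamma + 1, which pays the diagonal loss C /
   gamma and keeps a gain of f j. *)
pose mm := 1 + gamma^-1 * (C / gamma + 1).
have ga'0 : 0 < gamma^-1 by rewrite invr_gt0.
have ga'1 := ltW ga'0.
have Cg0 : 0 <= C / gamma by rewrite mulr_ge0.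
have mm1 : 1 <= mm by rewrite lerDl mulr_ge0// addr_ge0.
pose L := ((mm - 1) * C + 1) / (c1 / 2).
have L0 : 0 <= L.
  by rewrite divr_ge0 ?addr_ge0 ?mulr_ge0 ?subr_ge0// ltW.
pose f j := expR (L * (g j - 1)).
have f0 j : 0 < f j by exact: expR_gt0.
have f1 j : f j <= 1.
  by rewrite -expR0 ler_expR mulr_ge0_le0// subr_le0.
(* The gain f j is at least e^-L because g >= 0. Only the diagonal term can be negative, and it is
   at least - C / gamma because f <= 1. *)
exists f, (expR (- L)), (C / gamma); split.
- exact: expR_gt0.
- exact: Cg0.
- by move=> j; rewrite ltW//=.
- move=> j a ha haj n.
  have [jn|jn] := boolP (j \in initial I n); last first.
    rewrite (@le_trans _ _ 0) ?oppr_le0 ?mulr_ge0 ?(ltW ga'0)//.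
    rewrite big_seq sumr_ge0// => i iin; rewrite mulr_ge0 ?(ltW (f0 _))//.
    have ij : i != j by apply: contraNneq jn => <-.
    by apply: le_trans (ha _ ij); rewrite mulr_ge0 ?A0// ltW.
  rewrite (bigD1_seq j) ?initial_uniq//= -[leLHS]addr0 lerD//; last first.
    rewrite sumr_ge0// => i ij; rewrite mulr_ge0 ?(ltW (f0 _))//.
    by apply: le_trans (ha _ ij); rewrite mulr_ge0 ?A0// ltW.
  have ajC : - (C / gamma) <= a j.
    apply: le_trans haj; rewrite -mulNr ler_wpM2r ?(ltW ga'0)//.
    by have := HC j j; rewrite ler_norml => /andP[].
  apply: (@le_trans _ _ (- (C / gamma) * f j)).
    by rewrite mulNr lerN2 ler_piMr// mulr_ge0// ltW.
  by rewrite ler_wpM2r// ltW.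
move=> j jx.
(* With precision c1 / 2, the mass leaking out of the cutoff costs at most half of the drift g j >=
   c1. *)
have [n Hn] := rate_partial_sum_cvg0 j (c1 / 2) (divr_gt0 c10 (ltr0Sn _ 1)).
exists n => m /Hn{Hn}[jm sm] a ha haj.
have uI := initial_uniq I m.
set F := initial I m in jm sm uI *.
have gj0 : 0 < g j by apply: lt_le_trans (gc1 j).
have := g_drift F j uI jm jx gj0.
have s0 := rate_partial_sum_le0 F j uI jm.
set s := \sum_(i <- F) A i j in sm s0 *.
have Es : \sum_(i <- F | i != j) A i j = s - A j j.
  by rewrite /s [in RHS](bigD1_seq j)//= [RHS]addrC addKr.
have sC : s - A j j <= C.
  by have := HC j j; rewrite ler_norml => /andP[]; lra.
have EK : \sum_(i <- F | i != j) A i j * (g i - g j)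
    = \sum_(i <- F) A i j * g i - s * g j.
  rewrite /s mulr_suml -sumrB [RHS](bigD1_seq j)//= subrr add0r.
  by apply: eq_bigr => i _; rewrite mulrBr.
move=> gsup.
have K1 : c1 / 2 <= \sum_(i <- F | i != j) A i j * (g i - g j).
  rewrite EK; have := gc1 j; have := g_le1 j; nra.
(* Tangent line of exp at [mm]: its slope e^mm amplifies the net drift of g, with no need to
   separate upward from downward jumps. *)
have fE i : expR mm * (1 + (L * (g i - g j) - mm)) * f j <= f i.
  have -> : f i = expR mm * expR (L * (g i - g j) - mm) * f j.
    by rewrite /f -!expRD; congr expR; ring.
  by rewrite ler_wpM2r ?(ltW (f0 _))// ler_wpM2l ?expR_ge0// expR_ge1Dx.
have low : gamma * (expR mm * f j) * (L * (c1 / 2) - (mm - 1) * C)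
    <= \sum_(i <- F | i != j) a i * f i.
  apply: (@le_trans _ _ (\sum_(i <- F | i != j)
      (gamma * A i j) * (expR mm * (1 + (L * (g i - g j) - mm)) * f j))).
    rewrite (eq_bigr (fun i => gamma * (expR mm * f j) *
      (L * (A i j * (g i - g j)) - (mm - 1) * A i j))); last by move=> i _; ring.
    rewrite -mulr_sumr sumrB -!mulr_sumr Es ler_wpM2l//.
      by rewrite !mulr_ge0// ?expR_ge0// ltW.
    by rewrite lerB// ler_wpM2l// subr_ge0.
  apply: ler_sum => i ij; apply: (@le_trans _ _ (gamma * A i j * f i)).
    by rewrite ler_wpM2l// mulr_ge0 ?A0// ltW.
  by rewrite ler_wpM2r ?ha// ltW.
rewrite (bigD1_seq j)//=.
have ajC : - (C / gamma) <= a j.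
  apply: le_trans haj; rewrite -mulNr ler_wpM2r ?(ltW ga'0)//.
  by have := HC j j; rewrite ler_norml => /andP[].
have LK : L * (c1 / 2) - (mm - 1) * C = 1.
  by rewrite /L divfK ?gt_eqF ?divr_gt0//; ring.
rewrite LK mulr1 in low.
have emm : C / gamma + 1 <= gamma * expR mm.
  have : gamma * (1 + mm) <= gamma * expR mm by rewrite ler_wpM2l ?expR_ge1Dx// ltW.
  have -> : gamma * (1 + mm) = 2 * gamma + (C / gamma + 1).
    by rewrite /mm; field; rewrite gt_eqF.
  by have := ga0; lra.
apply: (@le_trans _ _ (f j)).
  rewrite /f ler_expR -[leLHS]mulr1 mulNr -mulrN ler_wpM2l//.
  by have := g_ge0 j; lra.
have t1 : - (C / gamma) * f j <= a j * f j by rewrite ler_wpM2r// ltW.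
have t2 : (C / gamma + 1) * f j <= gamma * expR mm * f j by rewrite ler_wpM2r// ltW.
move: t1 t2 low; rewrite mulrDl mul1r mulNr -!mulrA; lra.
Qed.

End potential.

(** * Paths, filtrations and hitting times *)

Definition stays_in {R : realType} {T I : Type} (X : R -> T -> I) (a b : R)
    (G : set I) : set T :=
  [set w | forall u, a <= u <= b -> G (X u w)].

Section paths.
Context {d : measure_display} {T : measurableType d} {R : realType}.
Context {I : countType} {X : R -> T -> I}.
Hypothesis HX : right_continuous_pure_jump X.

Lemma natural_filtration_preimage (s t : R) (G : set I) : 0 <= s <= t ->
  natural_filtration X t (X s @^-1` G).
Proof.
move=> st; rewrite /natural_filtration; set gens := (X in <<s X >>).
have -> : X s @^-1` G = \bigcup_i (if i \in G then X s @^-1` [set i] else set0).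
  apply/seteqP; split=> [w /= Gw|w [i _]].
    by exists (X s w) => //; rewrite mem_set.
  by case: ifPn => // /set_mem Gi /= ->.
apply: (@countable_bigcupT_measurable _ (g_sigma_algebraType gens)) => // i.
case: ifPn => _; last exact: measurable0.
by apply: sub_sigma_algebra; exists i => //; exists s.
Qed.

(** By right-continuity the value at u < b is also taken at a rational between u and b, so rational
    times suffice. The endpoint b is tested separately, since later times are not allowed. *)
Lemma natural_filtration_stays_in (a b : R) (G : set I) : 0 <= a <= b ->
  natural_filtration X b (stays_in X a b G).
Proof.
move=> /andP[a0 ab].
have -> : stays_in X a b G = X b @^-1` G `&`
    \bigcap_n (if @unpickle rat n is Some q then
      if a <= ratr q <= b then X (ratr q) @^-1` G else setT else setT).
  apply/seteqP; split=> [w Gw|w [/= Gb Gq] u /andP[au]].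
    split => [|n _]; first by apply: Gw; rewrite ab lexx.
    by case: unpickle => // q; case: ifPn => //; exact: Gw.
  rewrite le_eqVlt => /predU1P[->//|ub].
  have [+ _] := HX w => /(_ u (le_trans a0 au))[/= e e0 He].
  have : u < Num.min (u + e) b by rewrite lt_min ltrDl e0.
  move=> /rat_in_itvoo[q]; rewrite in_itv /= lt_min => /and3P[uq qe qb].
  have <- : X (ratr q) w = X u w.
    by apply: (He (ratr q) _ uq); rewrite /= ltr_distlC qe andbT ltrBlDr ltr_wpDr// ltW.
  have := Gq (pickle q) Logic.I; rewrite pickleK (le_trans au (ltW uq)) (ltW qb).
  exact.
rewrite /natural_filtration; set gens := (X in <<s X >>).
apply: (@measurableI _ (g_sigma_algebraType gens)).
  by apply: natural_filtration_preimage; rewrite (le_trans a0 ab) lexx.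
apply: (@bigcapT_measurable _ (g_sigma_algebraType gens)) => n.
case: unpickle => [q|]; last exact: measurableT.
case: ifPn => [/andP[aq qb]|_]; last exact: measurableT.
by apply: natural_filtration_preimage; rewrite (le_trans a0 aq).
Qed.

(** Near every time the path is constant on each side, so by compactness it takes finitely many
    values on [a, b], and each of them eventually lies in [G n]. *)
Lemma stays_in_exhaustion (a b : R) (G : nat -> set I) (w : T) : 0 <= a ->
  (forall i, exists n, forall m, (n <= m)%N -> G m i) ->
  \forall n \near \oo, stays_in X a b (G n) w.
Proof.
move=> a0 hG.
have hG' i : \forall n \near \oo, G n i.
  by have [n hn] := hG i; exists n.
have [Hr Hl] := HX w.
have /compact_near_coveringP cov : compact `[a, b] by exact: segment_compact.
(* The guard [a <= u] is needed because neighbourhoods of a contain times before a, which may be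
   negative. *)
suff : \forall n \near \oo, `[a, b] `<=` (fun u => a <= u -> G n (X u w)).
  by apply: filterS => n H u /andP[au ub]; apply: H => //=; rewrite in_itv/= au.
apply: (cov _ _ (fun n u => a <= u -> G n (X u w))) => x.
rewrite /= in_itv/= => /andP[ax xb].
have x0 := le_trans a0 ax.
have near_r : \forall u \near x, x < u -> X u w = X x w by exact: (Hr x x0).
have [i near_l] : exists i, \forall u \near (x : R), u < x -> a <= u -> X u w = i.
  move: ax; rewrite le_eqVlt => /predU1P[<-|ax].
    by exists (X a w); near=> u => /lt_geF ->.
  have [i Hi] := Hl x (le_lt_trans a0 ax); exists i.
  by near=> u => ux _; move: ux; near: u; exact: Hi.
near=> u n.
have Gi : G n i by near: n; exact: hG'.
have Gx : G n (X x w) by near: n; exact: hG'.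
have ul : u < x -> a <= u -> X u w = i by near: u.
have ur : x < u -> X u w = X x w by near: u.
by move=> /= au; case: (ltgtP u x) => [/ul ->|/ur ->|->].
Unshelve. all: by end_near. Qed.

(** The bounds on the compensator refer to left limits, the avoidance events to the values of X. The
    left limit is attained just before u, hence inside [a, b] as soon as a < u. *)
Lemma stays_in_left_limit (a b u : R) (G : set I) (w : T) : 0 <= a ->
  a < u <= b -> stays_in X a b G w -> G (left_limit X u w).
Proof.
move=> a0 /andP[au ub] Gw; have u0 := le_lt_trans a0 au.
rewrite /left_limit leNgt u0 /=.
have [_ /(_ u u0)[i Hi]] := HX w.
have -> : xget (X 0 w) [set i | \forall s \near u^'-, X s w = i] = i.
  apply: xget_unique => // j /= Hj; near (u : R)^'- => s.
  by transitivity (X s w); [symmetry|]; near: s.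
near (u : R)^'- => s.
have <- : X s w = i by near: s.
apply: Gw; apply/andP; split; apply: ltW; first by near: s; exact: nbhs_left_gt.
by rewrite (lt_le_trans _ ub)//; near: s; exact: nbhs_left_lt.
Unshelve. all: by end_near. Qed.

End paths.

(** This makes the path of a predictable process Borel in time, so that the compensator can be
    integrated for each fixed outcome. *)
Lemma predictable_section {d : measure_display} {T : measurableType d}
    {R : realType} (F : R -> set (set T))
    (D : set (R * T)) (w : T) : predictable_sets F D ->
  measurable [set t | D (t, w)].
Proof.
suff : predictable_sets F `<=` [set D | measurable [set t | D (t, w)]] by exact.
apply: smallest_sub => [|_ [[B _ ->]|[s [t [B [_ _ _ ->]]]]]].
- split=> /= [|C mC|C mC].
  + by rewrite [X in measurable X](_ : _ = set0)//; apply/seteqP; split.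
  + have -> : [set t | ((`[0, +oo[ `*` setT) `\` C) (t, w)]
        = (`[0, +oo[%classic : set R) `\` [set t | C (t, w)].
      by apply/seteqP; split=> t /= [] => [[]|].
    by apply: measurableD => //; exact: measurable_itv.
  + have -> : [set t | (\bigcup_k C k) (t, w)] = \bigcup_k [set t | C k (t, w)].
      by apply/seteqP; split=> t.
    exact: bigcupT_measurable.
- have [Bw|Bw] := pselect (B w).
    suff E : [set u : R | ([set 0] `*` B) (u, w)] = [set 0] by rewrite /= in E *; rewrite E.
    by apply/seteqP; split=> t //= [].
  suff E : [set u : R | ([set 0] `*` B) (u, w)] = set0 by rewrite /= in E *; rewrite E.
  by apply/seteqP; split=> t //= [].
- have [Bw|Bw] := pselect (B w).
    suff E : [set u : R | (`]s, t] `*` B) (u, w)] = `]s, t]%classic.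
      by rewrite /= in E *; rewrite E; exact: measurable_itv.
    by apply/seteqP; split=> u //= [].
  suff E : [set u : R | (`]s, t] `*` B) (u, w)] = set0 by rewrite /= in E *; rewrite E.
  by apply/seteqP; split=> u //= [].
Qed.

Lemma predictable_path_measurable {d : measure_display} {T : measurableType d}
    {R : realType} (F : R -> set (set T)) (f : R -> T -> R) (w : T) :
  predictable F f -> measurable_fun (`[0, +oo[%classic : set R) (f^~ w).
Proof.
move=> pf _ B mB; have := predictable_section F _ w (pf B mB).
congr measurable; apply/seteqP; split=> t /= [].
  by move=> t0 Bt; rewrite in_itv/= t0.
by rewrite in_itv/= andbT.
Qed.

Lemma ratio_bounds (R : realType) (gamma a b : R) : 0 < gamma ->
  gamma <= Defs.ratio a b <= gamma^-1 ->
  [/\ 0 <= b -> gamma * b <= a, b <= 0 -> b / gamma <= a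
    & `|a| <= `|b| / gamma].
Proof.
move=> g0; rewrite /Defs.ratio; have [->|b0] := eqVneq b 0.
  (* A zero rate forces a = 0: otherwise the ratio is a / 0 = 0, which is below gamma. *)
  rewrite andbT; have [->|a0] := eqVneq a 0; last by rewrite invr0 mulr0 leNgt g0.
  by rewrite normr0 mulr0 mul0r; split.
rewrite andbF => /andP[h1 h2].
have -> : a = a / b * b by rewrite divfK.
split.
- by move=> ?; rewrite ler_wpM2r.
- by move=> ?; rewrite mulrC ler_wnM2r.
- rewrite normrM mulrC ler_wpM2l// ger0_norm//; exact: le_trans (ltW g0) h1.
Qed.

Section filtration.
Context {d : measure_display} {T : measurableType d} {R : realType}.
Context {I : countType} {X : R -> T -> I} {P : probability T R}.

Lemma natural_filtration_filt (t : R) : natural_filtration X t `<=` filt X P t.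
Proof. by move=> B hB; apply: sub_sigma_algebra; left. Qed.

Lemma filt_mono (s t : R) : s <= t -> filt X P s `<=` filt X P t.
Proof.
move=> st; apply: smallest_sub; first exact: smallest_sigma_algebra.
move=> B [hB|hB]; last by apply: sub_sigma_algebra; right.
apply: natural_filtration_filt; move: B hB; apply: sub_sigma_algebra2.
by move=> _ [i _ [u /= /andP[u0 us] <-]]; exists i => //; exists u => //=;
   rewrite u0 (le_trans us).
Qed.

Lemma filt_infty_filt (t : R) : filt X P t `<=` filt_infty X P.
Proof.
apply: smallest_sub; first exact: smallest_sigma_algebra.
move=> B [hB|hB]; apply: sub_sigma_algebra; [left|by right].
move: B hB; apply: sub_sigma_algebra2.
by move=> _ [i _ [u /= /andP[u0 us] <-]]; exists i => //; exists u.
Qed.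

End filtration.

Section hitting.
Context {d : measure_display} {T : measurableType d} {R : realType}.
Context {I : countType} {X : R -> T -> I}.

Lemma hitting_time_ge0 (x : I) (w : T) : (0 <= hitting_time X x w)%E.
Proof. by apply: le_ereal_inf_tmp => _ [t [t0 _] <-]; rewrite lee_fin. Qed.

Lemma hitting_time_le (x : I) (a b : R) (w : T) : 0 <= a ->
  ~ stays_in X a b [set~ x] w -> (hitting_time X x w <= b%:E)%E.
Proof.
move=> a0 /existsNP[u /not_implyP[/andP[au ub] /contrapT xu]].
apply: (@le_trans _ _ u%:E); last by rewrite lee_fin.
by apply: ereal_inf_lbound; exists u => //; split => //; exact: le_trans au.
Qed.

(** An infimum below r is witnessed by a visit before r, hence by a rational between that visit and
    r; this makes the event a countable union. *)
Lemma measurable_hitting_time (x : I) :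
  (forall b G, 0 <= b -> measurable (stays_in X 0 b G)) ->
  measurable_fun setT (hitting_time X x : T -> \bar R).
Proof.
move=> mS.
apply: (measurability _ (ErealGenInftyO.measurableE R)) => _ /= -[_ [r ->] <-].
rewrite setTI.
have -> : hitting_time X x @^-1` `]-oo, r%:E[ =
    \bigcup_n (if @unpickle rat n is Some q then
      if 0 <= (ratr q : R) < r then ~` stays_in X 0 (ratr q) [set~ x] else set0
      else set0).
  apply/seteqP; split=> [w|w [n _]] /=.
    rewrite in_itv/= => /ereal_inf_lt[_ [u [u0 Xu] <-]]; rewrite lte_fin => ur.
    have [q] := rat_in_itvoo ur; rewrite in_itv /= => /andP[uq qr].
    exists (pickle q); first exact: Logic.I.
    rewrite pickleK (le_trans u0 (ltW uq)) qr => /(_ u).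
    by rewrite u0 (ltW uq) => /(_ isT).
  case: unpickle => // q; case: ifPn => // /andP[q0 qr] /(hitting_time_le _ _ _ _ (lexx _)) h.
  by rewrite in_itv/= (le_lt_trans h)// lte_fin.
apply: bigcupT_measurable => n; case: unpickle => // q; case: ifPn => // /andP[q0 _].
exact: measurableC (mS _ _ q0).
Qed.
End hitting.

(** * Avoiding the target over one time step *)

Lemma martingale_increments_sum {d : measure_display} {T : measurableType d}
    {R : realType} (Q : probability T R) (F : R -> set (set T)) (I : Type)
    (M : I -> R -> T -> R) (f : I -> R) (r : seq I) (s t : R) (B : set T) :
  (forall i, is_martingale Q F (M i)) -> 0 <= s -> s <= t -> F s B ->
  measurable B ->
  Q.-integrable B (fun w => (\sum_(i <- r) f i * (M i t w - M i s w))%:E) /\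
  (\int[Q]_(w in B) (\sum_(i <- r) f i * (M i t w - M i s w))%:E = 0)%E.
Proof.
move=> mart s0 st FB mB.
have int i : Q.-integrable B (fun w => (M i t w - M i s w)%:E).
  have [_ intM _] := mart i.
  apply: (integrableS measurableT) => //.
  rewrite [X in integrable _ _ X](_ : _ = (EFin \o M i t) \- (EFin \o M i s))%E; last first.
    by apply/funext => w; rewrite /= EFinB.
  by apply: integrableB => //; apply: intM => //; exact: le_trans st.
have int0 i : (\int[Q]_(w in B) (M i t w - M i s w)%:E = 0)%E.
  have [_ intM eqM] := mart i.
  rewrite (eq_integral (fun w => (M i t w)%:E - (M i s w)%:E)%E)//.
  have ints : Q.-integrable B (EFin \o M i s).
    by apply: (integrableS measurableT) => //; exact: intM.
  have intt : Q.-integrable B (EFin \o M i t).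
    by apply: (integrableS measurableT) => //; apply: intM => //; exact: le_trans st.
  rewrite integralB// (eqM s t B)// subee//.
  exact: integrable_fin_num.
elim: r => [|i r [IHint IH0]].
  split; last by apply: integral0_eq => w _; rewrite big_nil.
  by apply: (eq_integrable _ (fun=> 0%E)) => // [w _|]; rewrite ?big_nil//; exact: integrable0.
have intf : Q.-integrable B (fun w => ((f i)%:E * (M i t w - M i s w)%:E)%E).
  exact: integrableZl.
have eqf : {in B, (fun w => (f i)%:E * (M i t w - M i s w)%:E
      + (\sum_(i <- r) f i * (M i t w - M i s w))%:E)%E
    =1 (fun w => (\sum_(i <- i :: r) f i * (M i t w - M i s w))%:E)}.
  by move=> w _; rewrite big_cons -EFinM -EFinD.
split; first by apply: (eq_integrable _ _ _ eqf) => //; exact: integrableD.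
rewrite -(eq_integral _ _ eqf) integralD// integralZl// int0 mule0 add0e//.
Qed.

Section path_integral.
Context {R : realType} {I : Type} {h : I -> R -> R} {K : R}.
Hypothesis mh : forall i, measurable_fun (`[0, +oo[%classic : set R) (h i).
Hypothesis hK : forall i (u : R), 0 <= u -> `|h i u| <= K.
Local Notation leb := (@lebesgue_measure R).

Let finite_itv (s t : R) : (lebesgue_measure (`]s, t]%classic : set R) < +oo)%E.
Proof. by rewrite lebesgue_measure_itv/=; case: ifP => // _; rewrite -EFinB ltry. Qed.

Let integrable_h i (s t : R) : 0 <= s -> leb.-integrable `]s, t] (EFin \o h i).
Proof.
move=> s0; apply: measurable_bounded_integrable => //.
- exact: finite_itv.
- apply: measurable_funS (mh i) => //.
  by move=> u /=; rewrite !in_itv/= andbT => /andP[/ltW su _]; exact: le_trans su.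
- exists K; split; first exact: num_real.
  move=> M KM u /=; rewrite in_itv/= => /andP[/ltW su _].
  by apply: le_trans (ltW KM); apply: hK; exact: le_trans su.
Qed.

Lemma path_integral_ge (f : I -> R) (r : seq I) (k s t : R) :
  0 <= s -> s <= t ->
  (forall u, s < u -> u <= t -> k <= \sum_(i <- r) h i u * f i) ->
  k * (t - s) <= \sum_(i <- r) f i * (\int[lebesgue_measure]_(u in `]0, t]) h i u
                                - \int[lebesgue_measure]_(u in `]0, s]) h i u).
Proof.
move=> s0 st hk.
have E i : \int[leb]_(u in `]0, t]) h i u - \int[leb]_(u in `]0, s]) h i u
    = \int[leb]_(u in `]s, t]) h i u.
  have sp : (`]0, t]%classic : set R) = `]0, s] `|` `]s, t].
    by rewrite -itv_bndbnd_setU// bnd_simp.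
  have int0t : leb.-integrable (`]0, s] `|` `]s, t]) (EFin \o h i).
    by rewrite -sp; exact: integrable_h.
  rewrite sp Rintegral_setU//; first by rewrite [LHS]addrAC subrr add0r.
  rewrite disj_set2E; apply/eqP; apply/seteqP; split=> u //= [].
  rewrite !in_itv/= => /andP[_ us] /andP[su _].
  by move: (lt_le_trans su us); rewrite ltxx.
have [isum sumE] : leb.-integrable `]s, t] (fun u => (\sum_(i <- r) h i u * f i)%:E) /\
   \int[leb]_(u in `]s, t]) (\sum_(i <- r) h i u * f i) =
   \sum_(i <- r) f i * \int[leb]_(u in `]s, t]) h i u.
  elim: r {hk} => [|i r [IH1 IH2]].
    split; last first.
      rewrite big_nil; under eq_Rintegral do rewrite big_nil.
      by rewrite Rintegral_cst// mul0r.
    by apply: (eq_integrable _ (fun=> 0%E)) => // [w _|];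
       rewrite ?big_nil//; exact: integrable0.
  have intf : leb.-integrable `]s, t] (fun u => (h i u * f i)%:E).
    have : leb.-integrable `]s, t] (fun u => (f i)%:E * (EFin \o h i) u)%E.
      by apply: integrableZl => //; exact: integrable_h.
    by apply: eq_integrable => // u _; rewrite /= -EFinM mulrC.
  split.
    have : leb.-integrable `]s, t]
        (fun u => (h i u * f i)%:E + (\sum_(i <- r) h i u * f i)%:E)%E.
      exact: integrableD.
    by apply: eq_integrable => // u _; rewrite big_cons EFinD.
  under eq_Rintegral do rewrite big_cons.
  rewrite RintegralD// IH2 big_cons; congr (_ + _).
  under eq_Rintegral do rewrite mulrC.
  by rewrite RintegralZl//; exact: integrable_h.
under eq_bigr do rewrite E.
rewrite -sumE.
have -> : k * (t - s) = \int[leb]_(u in `]s, t]) k.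
  have leE : (leb (`]s, t]%classic : set R) = (t - s)%:E)%E.
    rewrite lebesgue_measure_itv/= lte_fin -EFinB.
    by move: st; rewrite le_eqVlt => /predU1P[->|->]//; rewrite ltxx subrr.
  by transitivity (k * fine (leb (`]s, t]%classic : set R)));
    [rewrite leE|rewrite Rintegral_cst].
apply: le_Rintegral => //.
  apply: measurable_bounded_integrable => //.
    exact: finite_itv.
  by exists `|k|; split => // M kM u _; exact: ltW.
by move=> u /=; rewrite in_itv/= => /andP[su ut]; exact: hk.
Qed.

End path_integral.

(** The sum is f cut off to r and evaluated at y: it equals [f y] if y is in r and 0 otherwise. *)
Lemma bvec_weighted_sum (R : realType) (I : countType) (f : I -> R) (y : I)
    (r : seq I) : (forall i, 0 <= f i <= 1) -> uniq r ->
  0 <= \sum_(i <- r) f i * bvec y i <= 1.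
Proof.
move=> hf ur; have f0 i : 0 <= f i by case/andP: (hf i).
rewrite sumr_ge0/=; last by move=> i _; rewrite mulr_ge0// /bvec ler0n.
have [yr|yr] := boolP (y \in r).
  rewrite (bigD1_seq y)//= big1 ?addr0 /bvec ?eqxx ?mulr1; first by case/andP: (hf y).
  by move=> i /negbTE ->; rewrite mulr0.
rewrite big_seq big1// => i ir; rewrite /bvec (_ : _ == _ = false) ?mulr0//.
by apply: contraNF yr => /eqP <-.
Qed.

Lemma integral_le_cst {d : measure_display} {T : measurableType d}
    {R : realType} (Q : probability T R) (E : set T) (h : T -> R) (a : R) :
  measurable E -> Q.-integrable E (EFin \o h) -> (forall w, E w -> h w <= a) ->
  (\int[Q]_(w in E) (h w)%:E <= a%:E * Q E)%E.
Proof.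
move=> mE ih ha; rewrite -integral_cst//.
apply: le_integral => //.
  exact: finite_measure_integrable_cst.
by move=> w /set_mem Ew; rewrite lee_fin; exact: ha.
Qed.

Lemma powR_geometric_sum_bounded (R : realType) (p S theta : R) :
  0 < p -> 0 < S -> 0 < theta < 1 ->
  exists2 K, 0 <= K & forall N,
    \sum_(0 <= n < N) (1 + n.+1%:R * S) `^ p * theta ^+ n <= K.
Proof.
move=> p0 S0 /andP[th0 th1].
have l0 : 0 < - ln theta by rewrite oppr_gt0 ln_lt0// th0.
(* From ln (e y) <= e y - 1, the power grows at most like exp (n p e S). This e makes p e S = - ln
   theta / 2, so the growth uses up half of the decay and the ratio [s], the square root of theta,
   remains. *)
pose e := - ln theta / (2 * p * S).
have e0 : 0 < e by rewrite divr_gt0// !mulr_gt0.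
pose s := expR (ln theta / 2).
have s0 : 0 < s by exact: expR_gt0.
have s1 : 0 < 1 - s by rewrite subr_gt0 -expR0 ltr_expR; lra.
pose K := expR (p * (e * (1 + S) - 1 - ln e)).
exists (K / (1 - s)); first by rewrite divr_ge0 ?expR_ge0// ltW.
move=> N; apply: (@le_trans _ _ (\sum_(0 <= n < N) K * s ^+ n)).
  apply: ler_sum_nat => n _.
  have x0 : 0 < 1 + n.+1%:R * S by rewrite addr_gt0// mulr_gt0.
  have lnle : ln (1 + n.+1%:R * S) <= e * (1 + n.+1%:R * S) - 1 - ln e.
    have ex0 : 0 < e * (1 + n.+1%:R * S) by rewrite mulr_gt0.
    have := @le_ln1Dx R (e * (1 + n.+1%:R * S) - 1).
    rewrite (_ : 1 + (_ - 1) = e * (1 + n.+1%:R * S)); last by ring.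
    rewrite lnM ?posrE// => h.
    have {}h : ln e + ln (1 + n.+1%:R * S) <= e * (1 + n.+1%:R * S) - 1.
      by apply: h; lra.
    by lra.
  have peS : p * e * S = - ln theta / 2.
    by rewrite /e; field; rewrite !gt_eqF.
  rewrite /powR gt_eqF// -[theta in leLHS]lnK ?posrE// -!expRM_natl -!expRD ler_expR.
  apply: (@le_trans _ _ (p * (e * (1 + n.+1%:R * S) - 1 - ln e) + n%:R * ln theta)).
    by rewrite lerD2r ler_wpM2l// ltW.
  have -> : p * (e * (1 + n.+1%:R * S) - 1 - ln e) =
      p * (e * (1 + S) - 1 - ln e) + n%:R * (p * e * S) by rewrite -natr1; ring.
  by rewrite peS; lra.
rewrite -mulr_sumr ler_wpM2l ?expR_ge0//.
rewrite -div1r ler_pdivlMr// mulrC.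
have -> : (1 - s) * \sum_(0 <= n < N) s ^+ n = 1 - s ^+ N.
  by rewrite big_mkord -[LHS]opprK -mulNr opprB -subrX1 opprB.
by rewrite lerBlDr lerDl exprn_ge0// ltW.
Qed.

Section visit.
Context {d : measure_display} {T : measurableType d} {R : realType}.
Context {I : countType} {X : R -> T -> I} {P Q : probability T R}.
Context {A : I -> I -> R} {Pt : R -> I -> I -> R} {nu : I -> R} {gamma : R}.
Hypothesis HX : right_continuous_pure_jump X.
Hypothesis HF : forall B : set T, measurable B <-> filt_infty X P B.
Hypotheses (HA : bounded_rate_matrix A) (HPt : transition_semigroup A Pt).
Hypotheses (Hergodic : uniformly_ergodic Pt nu) (gamma0 : 0 < gamma).
Variable x : I.
Hypothesis nux : 0 < nu x.
Hypothesis HQ : Q_family X P A gamma Q.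

Lemma filt_measurable t : filt X P t `<=` measurable.
Proof. by move=> B /filt_infty_filt/HF. Qed.

Lemma filt_stays_in (a b : R) (G : set I) : 0 <= a <= b ->
  filt X P b (stays_in X a b G).
Proof. by move=> ab; apply: natural_filtration_filt; exact: natural_filtration_stays_in. Qed.

Lemma visit_step : exists S theta : R, [/\ 0 < S, 0 < theta < 1 &
  forall t B, 0 <= t -> filt X P t B ->
    (Q (B `&` stays_in X t (t + S) [set~ x]) <= theta%:E * Q B)%E].
Proof.
have [lam [pred_lam _ ratio_lam comp_lam]] := HQ.
have [f [c [D [c0 D0 f01 lowD]]]] := robust_drift HA HPt Hergodic x nux gamma gamma0.
move=> drift.
have Ajj j : A j j <= 0.
  have := rate_partial_sum_le0 HPt [:: j] j isT (mem_head _ _).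
  by rewrite big_seq1.
have [A0 _ [C HC]] := HA.
have rate u w i : 0 <= u -> i != left_limit X u w ->
    gamma * A i (left_limit X u w) <= lam u w i.
  move=> u0 il; have [+ _ _] := ratio_bounds _ _ _ _ gamma0 (ratio_lam u w i u0).
  by apply; exact: A0.
have rate_diag u w : 0 <= u ->
    A (left_limit X u w) (left_limit X u w) / gamma <= lam u w (left_limit X u w).
  move=> u0; have [_ + _] := ratio_bounds _ _ _ _ gamma0 (ratio_lam u w (left_limit X u w) u0).
  by apply; exact: Ajj.
have lamK i w u : 0 <= u -> `|lam u w i| <= C / gamma.
  move=> u0; have [_ _ h] := ratio_bounds _ _ _ _ gamma0 (ratio_lam u w i u0).
  by apply: (le_trans h); rewrite ler_wpM2r// invr_ge0 ltW.
have mlam i w : measurable_fun (`[0, +oo[%classic : set R) (fun u => lam u w i).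
  exact: predictable_path_measurable (pred_lam i).
have /choice[th hth] : forall j, exists n, j != x -> forall m, (n <= m)%N ->
    forall (a : I -> R), (forall i, i != j -> gamma * A i j <= a i) ->
      A j j / gamma <= a j -> c <= \sum_(i <- initial I m) a i * f i.
  move=> j; have [->|jx] := eqVneq j x; first by exists 0%N.
  by have [n hn] := drift j jx; exists n.
(* Chosen so that 1 - c S = -1. *)
pose S := 2 / c.
have S0 : 0 < S by rewrite divr_gt0.
have DS0 : 0 <= D * S by rewrite mulr_ge0// ltW.
(* Over B the martingale increment has integral 0; it is at most -1 on the avoiding part E and at
   most 1 + D S on the rest. Hence (2 + D S) Q(E) <= (1 + D S) Q(B). *)
pose theta := (1 + D * S) / (2 + D * S).
have theta0 : 0 < theta by rewrite divr_gt0//; lra.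
exists S, theta; split => //.
  by rewrite theta0/= /theta ltr_pdivrMr ?mul1r; lra.
move=> t B t0 FB; have mB := filt_measurable _ _ FB.
have tS : t <= t + S by rewrite lerDl ltW.
have tS0 := le_trans t0 tS.
set nov := stays_in X t (t + S) [set~ x].
have mnov : measurable nov.
  by apply: (filt_measurable (t + S)); apply: filt_stays_in; rewrite t0.
(* The states at which the cutoff to m already has drift at least c, apart from x, which [nov]
   excludes. *)
pose G m := [set j | (th j <= m)%N].
pose V m := stays_in X t (t + S) (G m).
have mV m : measurable (V m).
  by apply: (filt_measurable (t + S)); apply: filt_stays_in; rewrite t0.
have step m : (Q (B `&` nov `&` V m) <= theta%:E * Q B)%E.
  pose M i v w := bvec (X v w) i - bvec (X 0 w) i
    - \int[lebesgue_measure]_(u in `]0, v]) lam u w i.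
  pose Phi w := \sum_(i <- initial I m) f i * (M i (t + S) w - M i t w).
  have [intPhi Phi0] : Q.-integrable B (EFin \o Phi) /\
      (\int[Q]_(w in B) (Phi w)%:E = 0)%E.
    exact: (martingale_increments_sum Q (filt X P) I M f _ t (t + S)).
  (* [Phi] is the increment of the cut-off f along the path, at most 1, minus the integrated
     drift. *)
  have bound k w : (forall u, t < u -> u <= t + S ->
      k <= \sum_(i <- initial I m) lam u w i * f i) -> Phi w <= 1 - k * S.
    move=> hk.
    have := path_integral_ge (fun i => mlam i w) (fun i => lamK i w) f _ _ _ _ t0 tS hk.
    rewrite addrAC subrr add0r => h.
    have /andP[_ b1] := bvec_weighted_sum R I f (X (t + S) w) _ f01 (initial_uniq I m).
    have /andP[b2 _] := bvec_weighted_sum R I f (X t w) _ f01 (initial_uniq I m).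
    rewrite /Phi /M.
    under eq_bigr => i _.
      rewrite (_ : f i * _ = f i * bvec (X (t + S) w) i - f i * bvec (X t w) i -
        f i * (\int[lebesgue_measure]_(u in `]0, t + S]) lam u w i -
               \int[lebesgue_measure]_(u in `]0, t]) lam u w i)); last by ring.
      over.
    by rewrite !sumrB; lra.
  have Phi_le w : Phi w <= 1 + D * S.
    rewrite -[D]opprK mulNr; apply: bound => u tu _.
    have u0 : 0 <= u by apply: ltW; exact: le_lt_trans tu.
    by apply: (lowD (left_limit X u w)) => [i|]; [exact: rate|exact: rate_diag].
  have Phi_leN w : nov w -> V m w -> Phi w <= - 1.
    move=> novw Vw; have -> : - 1 = 1 - c * S by rewrite /S mulrC divfK ?gt_eqF//; ring.
    apply: bound => u tu ut; have u0 : 0 <= u by apply: ltW; exact: le_lt_trans tu.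
    have tut : t < u <= t + S by rewrite tu.
    have /eqP lx := stays_in_left_limit HX _ _ _ _ _ t0 tut novw.
    have lm := stays_in_left_limit HX _ _ _ _ _ t0 tut Vw.
    by apply: (hth _ lx _ lm) => [i|]; [exact: rate|exact: rate_diag].
  set E := B `&` nov `&` V m.
  have mE : measurable E by apply: measurableI => //; exact: measurableI.
  have mBE : measurable (B `\` E) by exact: measurableD.
  have EB : E `<=` B by move=> w [[]].
  have BE : B = E `|` (B `\` E) by rewrite setDUK.
  have disj : [disjoint E & B `\` E] by rewrite disj_set2E setDIK.
  have QB : (Q B = Q E + Q (B `\` E))%E by rewrite {1}BE measureU// setDIK.
  have : (0 <= (- 1)%:E * Q E + (1 + D * S)%:E * Q (B `\` E))%E.
    rewrite -Phi0 {1}BE integral_setU//; last by rewrite -BE; case/integrableP : intPhi.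
    apply: leeD; apply: integral_le_cst => //.
    - exact: integrableS intPhi.
    - by move=> w [[_ nw] Vw]; exact: Phi_leN.
    - by apply: integrableS intPhi => //; exact: subDsetl.
  rewrite QB.
  rewrite -(fineK (fin_num_measure Q _ mE)) -(fineK (fin_num_measure Q _ mBE)).
  rewrite -!(EFinM, EFinD) !lee_fin /theta => h.
  rewrite -mulrA mulrC -mulrA ler_pdivlMl; lra.
have cvgQ : Q (B `&` nov `&` V m) @[m --> \oo] --> Q (B `&` nov).
  have E : \bigcup_m (B `&` nov `&` V m) = B `&` nov.
    rewrite -setI_bigcupr; apply/setIidPl => w _.
    have [n _ hn] : \forall n \near \oo, V n w.
      by apply: stays_in_exhaustion => // i; exists (th i).
    by exists n => //; apply: hn => /=.
  rewrite -[in X in _ --> X]E; apply: nondecreasing_cvg_mu.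
  - by move=> m; apply: measurableI => //; exact: measurableI.
  - by rewrite E; exact: measurableI.
  - move=> m n mn; apply/subsetPset; apply: setIS => w Vw u hu.
    by rewrite /G /= (leq_trans (Vw u hu)).
rewrite -(cvg_lim _ cvgQ)//; apply: lime_le; first by apply/cvg_ex; eexists; exact: cvgQ.
exact: nearW.
Qed.

(** * Geometric tail and moments of the hitting time *)

Lemma no_visit_geometric (S theta : R) : 0 < S -> 0 < theta < 1 ->
  (forall t B, 0 <= t -> filt X P t B ->
    (Q (B `&` stays_in X t (t + S) [set~ x]) <= theta%:E * Q B)%E) ->
  forall n t B, 0 <= t -> filt X P t B ->
    (Q (B `&` stays_in X t (t + n%:R * S) [set~ x]) <= (theta ^+ n)%:E * Q B)%E.
Proof.
move=> S0 /andP[th0 _] step; elim=> [|n IH] t B t0 FB.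
  have mB := filt_measurable _ _ FB.
  rewrite expr0 mul1e; apply: le_measure; rewrite ?inE//.
  apply: measurableI => //; apply: filt_measurable.
  by apply: filt_stays_in; rewrite t0 mul0r addr0 lexx.
have nS : 0 <= n%:R * S by rewrite mulr_ge0// ltW.
have tn : t <= t + n%:R * S by rewrite lerDl.
have tn0 := le_trans t0 tn.
have tnS : t + n%:R * S <= t + n.+1%:R * S.
  by rewrite lerD2l ler_wpM2r ?ler_nat// ltW.
(* Having avoided x up to t + n S is an event of the filtration at that time, so the one-step bound
   applies to it from there on. *)
set B' := B `&` stays_in X t (t + n%:R * S) [set~ x].
have FB' : filt X P (t + n%:R * S) B'.
  have mono := filt_mono _ _ tn _ FB.
  have stay : filt X P (t + n%:R * S) (stays_in X t (t + n%:R * S) [set~ x]).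
    by apply: filt_stays_in; rewrite t0.
  exact: (@measurableI _ (g_sigma_algebraType
    (natural_filtration X (t + n%:R * S) `|` null_sets X P)) _ _ mono stay).
apply: (@le_trans _ _ (theta%:E * Q B')%E); last first.
  rewrite exprS EFinM -muleA; apply: lee_wpmul2l; first by rewrite lee_fin ltW.
  exact: IH.
apply: le_trans (step _ _ tn0 FB'); apply: le_measure; rewrite ?inE.
- apply: measurableI; first exact: filt_measurable FB.
  by apply: filt_measurable; apply: filt_stays_in; rewrite t0 (le_trans tn).
- apply: measurableI; first exact: filt_measurable FB'.
  by apply: filt_measurable; apply: filt_stays_in; rewrite tn0 lerDl ltW.
- move=> w [Bw novw]; split; first split => //.
    by move=> u /andP[tu un]; apply: novw; rewrite tu (le_trans un).
  move=> u /andP[tu un]; apply: novw; rewrite (le_trans tn tu) (le_trans un)//.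
  by rewrite -natr1 mulrDl mul1r addrA.
Qed.

Lemma hitting_time_measurable : measurable_fun setT (hitting_time X x : T -> \bar R).
Proof.
apply: measurable_hitting_time => b G b0; apply: filt_measurable.
by apply: filt_stays_in; rewrite lexx.
Qed.

Lemma measurable_hitting_power (p : R) :
  measurable_fun setT (fun w => ((1 + hitting_time X x w) `^ p)%E).
Proof.
apply: (measurableT_comp (measurable_poweR p)).
apply: emeasurable_funD => //; exact: hitting_time_measurable.
Qed.

(** If the first n with a visit in [t, t + n S] is m + 1, the term of index m alone dominates; if it
    is 0, the term outside the series does. Without any visit all indicators are 1 and all
    coefficients at least 1, so the series is infinite. *)
Lemma hitting_power_le (p S t : R) (w : T) : 0 < p -> 0 < S -> 0 <= t ->
  ((1 + hitting_time X x w) `^ p <= ((1 + t) `^ p)%:E +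
    \sum_(0 <= n <oo) ((1 + t + n.+1%:R * S) `^ p)%:E *
      (\1_(stays_in X t (t + n%:R * S) [set~ x]) w)%:E)%E.
Proof.
move=> p0 S0 t0.
pose term n := (((1 + t + n.+1%:R * S) `^ p)%:E *
  (\1_(stays_in X t (t + n%:R * S) [set~ x]) w)%:E)%E.
rewrite -/(\sum_(0 <= n <oo) term n)%E.
have term0 n : (0 <= term n)%E.
  by rewrite /term -EFinM lee_fin mulr_ge0 ?powR_ge0.
have sum0 : (0 <= \sum_(0 <= n <oo) term n)%E by exact: nneseries_ge0.
have tau0 : (0 <= 1 + hitting_time X x w)%E by rewrite adde_ge0// hitting_time_ge0.
have le_of b : (hitting_time X x w <= b%:E)%E ->
    ((1 + hitting_time X x w) `^ p <= ((1 + b) `^ p)%:E)%E.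
  move=> h; rewrite -poweR_EFin; apply: gt0_ler_poweR; first exact: ltW.
  - by rewrite in_itv/= tau0 leey.
  - by rewrite in_itv/= leey andbT; apply: le_trans tau0 _; rewrite EFinD leeD2l.
  - by rewrite EFinD leeD2l.
have [[n nvis]|stay] := pselect (exists n, ~ stays_in X t (t + n%:R * S) [set~ x] w).
  have ex : exists n, `[< ~ stays_in X t (t + n%:R * S) [set~ x] w >].
    by exists n; apply/asboolP.
  case: (ex_minnP ex) => -[|m] /asboolP vis min.
    move: vis => /(hitting_time_le _ _ _ _ t0); rewrite mul0r addr0 => /le_of h.
    by rewrite (le_trans h)// leeDl.
  have stm : stays_in X t (t + m%:R * S) [set~ x] w.
    by apply: contrapT => /asboolP/min; rewrite ltnn.
  move: vis => /(hitting_time_le _ _ _ _ t0)/le_of h.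
  rewrite (le_trans h)//.
  apply: (@le_trans _ _ (term m)).
    by rewrite /term indicE mem_set// mule1 lee_fin addrA.
  apply: (@le_trans _ _ (\sum_(0 <= n <oo) term n)%E); last first.
    by rewrite leeDr// lee_fin powR_ge0.
  apply: le_trans (nneseries_lim_ge m.+1 _) => //.
  by rewrite big_nat_recr//= leeDr// sume_ge0.
suff -> : (\sum_(0 <= n <oo) term n = +oo)%E by rewrite addey// leey.
apply: eq_infty => r.
have [N rN] : exists N : nat, r <= N%:R.
  by exists (Num.bound `|r|); apply: le_trans (ler_norm r) (ltW (archi_boundP _)).
apply: le_trans (nneseries_lim_ge N _) => //.
apply: (@le_trans _ _ (\sum_(0 <= n < N) 1%:E)%E).
  by rewrite sumEFin big_mkord sumr_const card_ord lee_fin.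
apply: lee_sum => n _; rewrite /term indicE mem_set ?mule1; last first.
  by apply: contrapT => h; apply: stay; exists n.
have c1 : 1 <= 1 + t + n.+1%:R * S.
  by rewrite -addrA lerDl addr_ge0// mulr_ge0// ltW.
have := ge0_ler_powR (ltW p0) _ _ c1.
rewrite powR1 lee_fin; apply; rewrite nnegrE//.
exact: le_trans c1.
Qed.

Lemma hitting_moment_le (p : R) : 0 < p ->
  exists2 k, 0 <= k & forall t B, 0 <= t -> filt X P t B ->
    (\int[Q]_(w in B) ((1 + hitting_time X x w) `^ p)
      <= (k * (1 + t) `^ p)%:E * Q B)%E.
Proof.
move=> p0; have [S [theta [S0 th01 step]]] := visit_step.
have /andP[th0 th1] := th01.
have [K K0 HK] := powR_geometric_sum_bounded R p S theta p0 S0 th01.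
exists (1 + K) => [|t B t0 FB]; first by rewrite addr_ge0.
have mB := filt_measurable _ _ FB.
pose stay n := stays_in X t (t + n%:R * S) [set~ x].
have nS n : 0 <= n%:R * S by rewrite mulr_ge0// ltW.
have mstay n : measurable (stay n).
  by apply: (filt_measurable (t + n%:R * S)); apply: filt_stays_in; rewrite t0 lerDl nS.
pose c n := (1 + t + n.+1%:R * S) `^ p.
have c0 n : 0 <= c n by exact: powR_ge0.
pose term n w := ((c n)%:E * (\1_(stay n) w)%:E)%E.
have term0 n w : (0 <= term n w)%E.
  by rewrite /term -EFinM lee_fin mulr_ge0.
have mterm n : measurable_fun B (term n).
  by apply: measurable_funeM; apply/measurable_EFinP; exact: measurable_indic.
have msum : measurable_fun B (fun w => \sum_(0 <= n <oo) term n w)%E.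
  by apply: (@ge0_emeasurable_sum _ _ _ B term predT).
apply: (@le_trans _ _ (\int[Q]_(w in B)
    (((1 + t) `^ p)%:E + \sum_(0 <= n <oo) term n w))%E).
  apply: ge0_le_integral => //.
  - by move=> w _; exact: poweR_ge0.
  - apply: measurable_funTS; exact: measurable_hitting_power.
  - by apply: emeasurable_funD => //; exact: measurable_cst.
  - by move=> w _; exact: hitting_power_le.
rewrite ge0_integralD//; last 2 first.
- by move=> w _; rewrite lee_fin powR_ge0.
- by move=> w _; exact: nneseries_ge0.
rewrite integral_cst// integral_nneseries//.
have QBfin := fin_num_measure Q _ mB.
pose q := fine (Q B).
have QBq : Q B = q%:E by rewrite fineK.
have q0 : 0 <= q by exact: fine_ge0.
rewrite !QBq.
have -> : (((1 + K) * (1 + t) `^ p)%:E * q%:E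
    = ((1 + t) `^ p)%:E * q%:E + (K * (1 + t) `^ p * q)%:E)%E.
  by rewrite -!EFinM -EFinD; congr EFin; ring.
apply: leeD; first by rewrite /q fineK.
apply: lime_le; first by apply: is_cvg_nneseries => n _ _; exact: integral_ge0.
apply: nearW => N.
(* The inequality 1 + t + (n + 1) S <= (1 + t) (1 + (n + 1) S) separates t from n, which keeps [K]
   independent of t. *)
apply: (@le_trans _ _ (\sum_(0 <= n < N)
    ((1 + t) `^ p * q * ((1 + n.+1%:R * S) `^ p * theta ^+ n))%:E)%E).
  apply: lee_sum => n _.
  rewrite /term ge0_integralZl_EFin//; last first.
    by apply/measurable_EFinP; exact: measurable_indic.
  rewrite integral_indic// setIC.
  have := no_visit_geometric S theta S0 th01 step n t B t0 FB.
  rewrite QBq -/(stay n) => h.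
  apply: (@le_trans _ _ ((c n)%:E * ((theta ^+ n)%:E * q%:E))%E).
    by apply: lee_wpmul2l => //; rewrite lee_fin.
  rewrite -!EFinM lee_fin.
  have -> : (1 + t) `^ p * q * ((1 + n.+1%:R * S) `^ p * theta ^+ n) =
     (1 + t) `^ p * (1 + n.+1%:R * S) `^ p * (theta ^+ n * q) by ring.
  rewrite ler_wpM2r ?mulr_ge0 ?exprn_ge0// ?(ltW th0)//.
  have t10 : 0 <= 1 + t by rewrite addr_ge0.
  have s10 : 0 <= 1 + n.+1%:R * S by rewrite addr_ge0.
  rewrite -powRM// /c ge0_ler_powR ?nnegrE ?(ltW p0)//.
  - by rewrite addr_ge0.
  - by rewrite mulr_ge0.
  - rewrite mulrDl mul1r mulrDr mulr1 -!addrA lerD2l addrC.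
    by rewrite lerD2l lerDl mulr_ge0.
rewrite sumEFin lee_fin -mulr_sumr.
have -> : K * (1 + t) `^ p * q = (1 + t) `^ p * q * K by ring.
by rewrite ler_wpM2l// mulr_ge0 ?powR_ge0.
Qed.

End visit.

(** * Conditional expectations *)

(** Radon-Nikodym for the finite measure taking B to the integral of Z over B. The restriction of Q
    to the smaller sigma-algebra is encoded as the image of Q under the identity map [phi]. *)
Lemma cond_expectation_exists {d : measure_display} {T : measurableType d}
    {R : realType} (Q : probability T R) (S : set (set T)) (Z : T -> \bar R) :
  <<s S >> `<=` measurable -> measurable_fun setT Z ->
  (forall w, (0 <= Z w)%E) -> (\int[Q]_w Z w < +oo)%E ->
  exists Y, is_cond_expectation Q <<s S >> Z Y.
Proof.
move=> subS mZ Z0 Zfin.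
pose T' := g_sigma_algebraType S.
pose phi : T -> T' := fun w => w.
have mphi : measurable_fun setT phi by move=> _ B mB; rewrite setTI; exact: subS.
pose phi' : {mfun T >-> T'} := HB.pack phi (isMeasurableFun.Build _ _ _ _ phi mphi).
pose Q' : probability T' R := distribution Q phi'.
have intZ : Q.-integrable setT Z.
  apply/integrableP; split => //.
  by rewrite (eq_integral Z)// => w _; rewrite gee0_abs.
pose n : set T' -> \bar R := fun B => (\int[Q]_(w in (B : set T)) Z w)%E.
have n0 : n set0 = 0%E by exact: integral_set0.
have nge0 (B : set T') : (0 <= n B)%E by apply: integral_ge0 => w _; exact: Z0.
have nadd : semi_sigma_additive n.
  move=> F mF tF mUF.
  exact: (semi_sigma_additive_nng_induced mZ Z0 (fun i => subS _ (mF i)) tF (subS _ mUF)).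
pose nu0 : {measure set T' -> \bar R} := HB.pack n (isMeasure.Build _ T' R n n0 nge0 nadd).
have nfin : fin_num_fun nu0.
  by move=> B /subS mB; apply: integrable_fin_num => //; exact: integrableS intZ.
pose nu : {finite_measure set T' -> \bar R} :=
  HB.pack n nu0 (Measure_isFinite.Build _ T' R nu0 nfin).
have dom : nu `<< Q'.
  apply/null_content_dominatesP => B mB QB0.
  apply: null_set_integral => //; first exact: subS.
  exact: measurable_funTS.
have [Y [Y0 _ intY YE]] := radon_nikodym_sigma_finite dom.
have mY : measurable_fun setT Y by exact: measurable_int intY.
exists Y; split => // [B mB|B SB].
  by have := mY measurableT B mB; rewrite setTI.
have mB : measurable (B : set T') by [].
transitivity (\int[Q']_(w in (B : set T')) Y w)%E; last exact/esym/YE.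
rewrite /Q' /distribution ge0_integral_pushforward//; first exact: measurable_funTS.
Qed.

(** Testing on the event Y >= c + 1 / (n + 1), which lies in G, shows that it is null. These events
    cover Y > c, including Y infinite. *)
Lemma cond_expectation_le {d : measure_display} {T : measurableType d}
    {R : realType} (Q : probability T R) (G : set (set T)) (Z Y : T -> \bar R)
    (c : R) : 0 <= c -> G `<=` measurable ->
  (forall B, G B -> (\int[Q]_(w in B) Z w <= c%:E * Q B)%E) ->
  is_cond_expectation Q G Z Y -> {ae Q, forall w, (Y w <= c%:E)%E}.
Proof.
move=> c0 subG ZB [mY Y0 YZ].
pose E n := [set w | ((c + n.+1%:R^-1)%:E <= Y w)%E].
have GE n : G (E n).
  have -> : E n = Y @^-1` `[(c + n.+1%:R^-1)%:E, +oo[.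
    by apply/seteqP; split=> w; rewrite /E /= in_itv/= andbT.
  by apply: mY; exact: emeasurable_itv.
have mYT : measurable_fun setT Y by move=> _ B mB; rewrite setTI; apply: subG; exact: mY.
have QE n : Q (E n) = 0%E.
  have mE := subG _ (GE n).
  have : ((c + n.+1%:R^-1)%:E * Q (E n) <= c%:E * Q (E n))%E.
    apply: le_trans (ZB _ (GE n)); rewrite -YZ// -integral_cst//.
    apply: ge0_le_integral => //; first by move=> w _; rewrite lee_fin addr_ge0.
    exact: measurable_funTS.
  rewrite -(fineK (fin_num_measure Q _ mE)) -!EFinM lee_fin => h.
  have q0 : 0 <= fine (Q (E n)) by exact: fine_ge0.
  have n0 : 0 < n.+1%:R^-1 :> R by rewrite invr_gt0.
  congr EFin; apply/eqP; rewrite eq_le q0 andbT.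
  move: h n0; move: (fine _) (n.+1%:R^-1) => q e h e0.
  by rewrite -(pmulr_rle0 _ e0) -(lerD2l (c * q)) addr0 (mulrC e)
    (mulrC c) -mulrDr mulrC (mulrC q).
have : Q.-negligible (\bigcup_n E n).
  apply: negligible_bigcup => n.
  by apply/negligibleP; [exact: subG|exact: QE].
apply: negligibleS => w /= /negP; rewrite -ltNge => cY.
case Yw : (Y w) cY => [r| |]//=; last by exists 0%N; rewrite // /E /= Yw leey.
rewrite lte_fin => /ltr_add_invr[k /ltW ck].
by exists k; rewrite // /E /= Yw lee_fin.
Qed.

(** The constant k is fixed before t, while the exceptional null set may depend on t and on the
    version Y. Existence of a version keeps the bound from being vacuous. *)
Theorem corollary1 (R : realType) (d : measure_display) (T : measurableType d)
    (P : probability T R) (N : option nat) (X : R -> T -> idx N)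
    (A : idx N -> idx N -> R) (Pt : R -> idx N -> idx N -> R) (pi : idx N -> R)
    (HX : right_continuous_pure_jump X)
    (HF : forall B : set T, measurable B <-> filt_infty X P B)
    (HA : bounded_rate_matrix A)
    (HPt : transition_semigroup A Pt)
    (Hmarkov : markov_chain X P Pt)
    (Hergodic : uniformly_ergodic Pt pi)
    (gamma : R) (Hgamma : 0 < gamma)
    (xhat : idx N) (Hxhat : 0 < pi xhat)
    (beta : R) (Hbeta : 0 <= beta)
    (Q : probability T R) (HQ : Q_family X P A gamma Q) :
  exists k : R, forall t : R, 0 <= t ->
    (exists Y : T -> \bar R,
       is_cond_expectation Q (filt X P t)
         (fun w => ((1 + hitting_time X xhat w) `^ (1 + beta))%E) Y) /\
    (forall Y : T -> \bar R,
       is_cond_expectation Q (filt X P t)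
         (fun w => ((1 + hitting_time X xhat w) `^ (1 + beta))%E) Y ->
       {ae Q, forall w, (Y w <= (k * (1 + t) `^ (1 + beta))%:E)%E}).
Proof.
have p0 : 0 < 1 + beta by rewrite ltr_wpDr.
have [k k0 Hk] := hitting_moment_le HX HF HA HPt Hergodic Hgamma xhat Hxhat HQ _ p0.
have subF t : filt X P t `<=` measurable by exact: filt_measurable.
exists k => t t0; split; last first.
  move=> Y; apply: cond_expectation_le => //; first by rewrite mulr_ge0 ?powR_ge0.
  by move=> B FB; exact: Hk.
apply: cond_expectation_exists.
- exact: subF.
- exact: (measurable_hitting_power HX HF).
- by move=> w; exact: poweR_ge0.
(* The moment bound over the whole space gives the finite expectation required for existence. *)
have := Hk t setT t0 (@measurableT _ (g_sigma_algebraType _)).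
by move=> /le_lt_trans; apply; rewrite probability_setT mule1 ltry.
Qed.
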